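(* Let $n\ge 1$ be an integer, let $T_1,\dots,T_n\in\{0,1\}$ be independent Bernoulli random variables with $P(T_i=1)=q_i\in[0,1]$ (the $q_i$ possibly distinct), let $\bar q=\frac1n\sum_{i=1}^n q_i$ and $n\bar T=\sum_{i=1}^n T_i$, and let $\alpha\in[0,1]$. With the statistic $\hat q^f_\alpha(k,n)$, $k\in\{0,\dots,n\}$, defined in the context, the following two inequalities hold: $$P\big(\bar q\ \ge\ \hat q^f_\alpha(n\bar T,n)\big)\ \ge\ 1-\alpha,$$ $$P\big(\bar q\ \le\ 1-\hat q^f_\alpha(n(1-\bar T),n)\big)\ \ge\ 1-\alpha .$$
   Context: For $a,b>0$ and $x\in[0,1]$, $I_x(a,b)=\frac{\Gamma(a+b)}{\Gamma(a)\Gamma(b)}\int_0^x t^{a-1}(1-t)^{b-1}\,dt$ is the regularized incomplete Beta function, and for $\alpha\in[0,1]$, $I^{-1}_\alpha(a,b)$ is its inverse in $x$, i.e. the unique $x\in[0,1]$ with $I_x(a,b)=\alpha$. For integers $n\ge1$, $0\le c\le n-1$, $0\le s\le c$ and $\alpha\in[0,1]$ let $$S_n(c,\alpha,s)=\frac{s+(n-s)\,I^{-1}_{1-\alpha}(c-s+1,\,n-c)}{n},\qquad S_n(c,\alpha)=\max_{0\le s\le c,\ s\in\mathbb Z}S_n(c,\alpha,s).$$ For $0\le d\le n-1$ let $\alpha^\dagger=\alpha^\dagger(d,n)=I_{d/n}(d+1,n-d)$. For $-1\le d\le n-1$ and $\alpha\in[0,1]$ define $$\tilde f_\alpha(d,n)=\begin{cases}0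 & d=-1\\ 1-S_n(n-d-1,\alpha) & d\ge0,\ \alpha^\dagger<\alpha\le1\\ I^{-1}_\alpha(d+1,n-d) & d\ge0,\ 0\le\alpha\le\alpha^\dagger.\end{cases}$$ The statistic is $\hat q^f_\alpha(k,n)=\tilde f_\alpha(k-1,n)$ for $k\in\{0,1,\dots,n\}$. *)

(* Defs.v *)
From mathcomp Require Import all_boot all_order all_algebra.
From mathcomp Require Import all_classical all_reals all_analysis.

Set Implicit Arguments.
Unset Strict Implicit.
Unset Printing Implicit Defensive.

Import Order.TTheory GRing.Theory Num.Theory.
Import numFieldNormedType.Exports.

Local Open Scope classical_set_scope.
Local Open Scope ring_scope.

Definition Gamma (R : realType) (a : R) : R :=
  \int[lebesgue_measure]_(t in `[0, +oo[) (t `^ (a - 1) * expR (- t)).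

Definition inc_beta (R : realType) (x a b : R) : R :=
  Gamma (a + b) / (Gamma a * Gamma b) *
  \int[lebesgue_measure]_(t in `[0, x]) (t `^ (a - 1) * (1 - t) `^ (b - 1)).

(* The point [x] of [0, 1] with [inc_beta x a b = alpha]; for a, b > 0 and
   0 <= alpha <= 1 it exists and is unique. The default value 0 is used only
   outside this range. *)
Definition inc_beta_inv (R : realType) (alpha a b : R) : R :=
  xget 0 [set x : R | 0 <= x <= 1 /\ inc_beta x a b = alpha].

(* Meant for n >= 1, c <= n - 1 and s <= c, where the truncated subtractions
   on nat are exact. *)
Definition S_at (R : realType) (n c : nat) (alpha : R) (s : nat) : R :=
  (s%:R + (n - s)%:R * inc_beta_inv (1 - alpha) (c - s + 1)%:R (n - c)%:R)
  / n%:R.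

(* The maximum over 0 <= s <= c; the base value of the iterated maximum is the
   term s = 0, so it does not affect the result. *)
Definition S_max (R : realType) (n c : nat) (alpha : R) : R :=
  \big[Num.max/S_at n c alpha 0]_(0 <= s < c.+1) S_at n c alpha s.

Definition alpha_dagger (R : realType) (d n : nat) : R :=
  inc_beta (d%:R / n%:R) (d + 1)%:R (n - d)%:R.

(* [d] ranges over -1 <= d <= n - 1, so the negative case is d = -1. *)
Definition f_tilde (R : realType) (alpha : R) (d : int) (n : nat) : R :=
  match d with
  | Negz _ => 0
  | Posz d =>
      if alpha_dagger R d n < alpha then 1 - S_max n (n - d - 1) alpha
      else inc_beta_inv alpha (d + 1)%:R (n - d)%:R
  end.

Definition q_hat (R : realType) (alpha : R) (k n : nat) : R :=
  f_tilde alpha (k%:Z - 1) n.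

(* Mutual independence of finitely many {0, 1}-valued random variables: the
   product rule for every subfamily and all subsets of values. All subsets of
   bool are measurable. *)
Definition mutually_independent d (Omega : measurableType d) (R : realType)
    (P : probability Omega R) (n : nat) (T : 'I_n -> {RV P >-> bool}) : Prop :=
  forall (J : {set 'I_n}) (B : 'I_n -> set bool),
    P (\bigcap_(i in [set i : 'I_n | i \in J]) (T i @^-1` B i)) =
    (\prod_(i in J) P (T i @^-1` B i))%E.

(* The number of ones, n times the sample mean. *)
Definition count_ones d (Omega : measurableType d) (R : realType)
    (P : probability Omega R) (n : nat) (T : 'I_n -> {RV P >-> bool})
    (w : Omega) : nat :=
  (\sum_(i < n) T i w)%N.

Definition average (R : realType) (n : nat) (q : 'I_n -> R) : R :=
  (\sum_(i < n) q i) / n%:R.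

(* Main.v *)
(* A failure of the first bound means that the average of the [q i] lies below
   [q_hat alpha k n] for the observed count [k].  If [d + 1] is the smallest such
   [k], the failure event is contained in the event that more than [d] of the
   [T i] are 1, so it suffices to bound the probability of the latter by [alpha].
   Passing to [r i = 1 - q i], this is P(S <= c) for a Poisson-binomial sum S with
   [c = n - d - 1].  Hoeffding's argument: as a function of two parameters with
   fixed sum, P(S <= c) is affine in their product, with slope
   P(W = c) - P(W = c - 1) for the sum W of the other variables.  A maximiser
   for a fixed mean, chosen with least sum of squares, therefore has all its
   values in (0, 1) equal to some [a], and by unimodality of the binomial law
   it has no zeros if the mean exceeds [c] and no ones if it exceeds [c + 1].
   The remaining binomial tails are the incomplete Beta functions at integer
   parameters.  The values [s] in [S_max] are the numbers of ones of the possible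
   maximisers, and the second branch of [f_tilde] is the case of no ones.  The
   second inequality is the first one for the variables [1 - T i]. *)
Require Import Defs.
From mathcomp Require Import all_boot all_order all_algebra.
From mathcomp Require Import all_classical all_reals all_analysis.
From mathcomp Require Import ring lra zify.

Set Implicit Arguments.
Unset Strict Implicit.
Unset Printing Implicit Defensive.

Import Order.TTheory GRing.Theory Num.Theory.
Import numFieldNormedType.Exports.

Local Open Scope classical_set_scope.
Local Open Scope ring_scope.

(** * Poisson-binomial generating polynomials *)

Definition bern_poly (R : nzRingType) (x : R) : {poly R} := (1 - x)%:P + x *: 'X.

(** On the generating polynomial of a sum S this is the probability of S <= c. *)
Definition low_sum (R : nzRingType) (p : {poly R}) (c : nat) : R :=
  \sum_(k < c.+1) p`_k.

Lemma low_sumB (R : nzRingType) (p r : {poly R}) c :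
  low_sum (p - r) c = low_sum p c - low_sum r c.
Proof. by rewrite /low_sum -sumrB; apply: eq_bigr => i _; rewrite coefB. Qed.

Lemma low_sumZ (R : nzRingType) (x : R) (p : {poly R}) c :
  low_sum (x *: p) c = x * low_sum p c.
Proof. by rewrite mulr_sumr; apply: eq_bigr => i _; rewrite coefZ. Qed.

Lemma low_sum_1subX (R : comNzRingType) (p : {poly R}) c :
  low_sum ((1 - 'X) * p) c = p`_c.
Proof.
rewrite mulrBl mul1r mulrC low_sumB.
elim: c => [|c IH]; first by rewrite /low_sum !big_ord1 coefMX subr0.
rewrite /low_sum !(big_ord_recr c.+1) /= coefMX /=.
by rewrite opprD addrACA -/(low_sum _ _) -/(low_sum _ _) IH addrCA subrr addr0.
Qed.

(* The two polynomials differ by a multiple of [(1 - 'X) ^+ 2 * p], and one factor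
   [1 - 'X] telescopes in [low_sum]. *)
Lemma low_sum_spread (R : comNzRingType) (x y x' y' : R) (p : {poly R}) c :
  x + y = x' + y' ->
  low_sum (bern_poly x * (bern_poly y * p)) c
    - low_sum (bern_poly x' * (bern_poly y' * p)) c
  = (x * y - x' * y') * ((1 - 'X) * p)`_c.
Proof.
move=> exy; rewrite -low_sum_1subX -low_sumZ -low_sumB; congr (low_sum _ c).
have -> : y' = x + y - x' by rewrite exy addrAC subrr add0r.
rewrite /bern_poly -!mul_polyC !(rmorphB, rmorphD, rmorphM, rmorph1) /=.
ring.
Qed.

Lemma coef_bern_polyX (R : comNzRingType) (x : R) m j :
  (bern_poly x ^+ m)`_j = 'C(m, j)%:R * x ^+ j * (1 - x) ^+ (m - j).
Proof.
rewrite /bern_poly exprDn coef_sum.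
have [ltmj|lejm] := ltnP m j.
  rewrite bin_small // !mul0r big1 // => i _.
  rewrite coefMn exprZn -rmorphXn mul_polyC coefZ coefZ coefXn.
  by rewrite (_ : (j == i) = false) ?mulr0 ?mul0rn // gtn_eqF // (leq_trans (ltn_ord i)).
rewrite (bigD1 (Ordinal (lejm : (j < m.+1)%N))) //= big1 ?addr0.
  rewrite coefMn exprZn -rmorphXn mul_polyC !coefZ coefXn eqxx mulr1.
  by rewrite -[LHS]mulr_natl mulrA mulrAC.
move=> i neq; rewrite coefMn exprZn -rmorphXn mul_polyC !coefZ coefXn.
by rewrite (_ : (j == i) = false) ?mulr0 ?mul0rn // eq_sym; apply/negbTE.
Qed.

(* A shifted binomial law has nondecreasing masses up to its mode; the left-hand
   side is the mass at [c] minus the mass at [c - 1]. *)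
Lemma coef_1subX_bern_ge0 (R : realFieldType) (a : R) (u m c : nat) :
  0 < a < 1 -> c%:R < u%:R + m.+1%:R * a ->
  0 <= ((1 - 'X) * ('X^u * bern_poly a ^+ m))`_c.
Proof.
move=> /andP[a0 a1] hc.
have b0 : 0 <= 1 - a by rewrite subr_ge0 ltW.
have P j : 0 <= (bern_poly a ^+ m)`_j.
  by rewrite coef_bern_polyX !mulr_ge0 ?exprn_ge0 // ltW.
rewrite mulrCA mulrC coefMXn; case: ltnP => // leuc.
rewrite mulrBl mul1r coefB [_ * bern_poly a ^+ m]mulrC coefMX.
move: hc; rewrite -{1}(subnKC leuc) natrD ltrD2l.
case: (c - u)%N => [|j] hj /=; first by rewrite subr0.
have ltjm : (j < m)%N.
  by rewrite -ltnS -(ltr_nat R); apply: (lt_le_trans hj); rewrite ger_pMr ?ltr0n ?ltW.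
rewrite subr_ge0 !coef_bern_polyX.
have -> : (m - j = (m - j.+1).+1)%N by rewrite subnSK.
rewrite !exprS.
(* Common powers of [a] and [1 - a] cancel. Since (j+1) C(m, j+1) = (m-j) C(m, j), what remains
   amounts to j + 1 <= (m+1) a. *)
suff h : 'C(m, j)%:R * (1 - a) <= 'C(m, j.+1)%:R * a.
  have := ler_wpM2r (mulr_ge0 (exprn_ge0 j (ltW a0)) (exprn_ge0 (m - j.+1) b0)) h.
  by congr (_ <= _); ring.
have E : j.+1%:R * 'C(m, j.+1)%:R = (m - j)%:R * 'C(m, j)%:R :> R.
  by rewrite -!natrM mul_bin_left.
rewrite -(ler_pM2l (ltr0Sn R j)) [leRHS]mulrA E natrB ?(ltnW ltjm) //.
rewrite mulrCA [leRHS]mulrAC [leRHS]mulrC ler_wpM2l //.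
move: hj; rewrite -!natr1; lra.
Qed.

Definition poisson_binomial (R : nzRingType) (n : nat) (q : 'I_n -> R) : {poly R} :=
  \prod_(i < n) bern_poly (q i).

Lemma bern_poly0 (R : nzRingType) : bern_poly (0 : R) = 1.
Proof. by rewrite /bern_poly scale0r addr0 subr0. Qed.

Lemma bern_poly1 (R : nzRingType) : bern_poly (1 : R) = 'X.
Proof. by rewrite /bern_poly subrr scale1r add0r. Qed.

Lemma low_sumXnM (R : nzRingType) (p : {poly R}) u c :
  low_sum ('X^u * p) c = if (c < u)%N then 0 else low_sum p (c - u).
Proof.
rewrite /low_sum; case: ltnP => [ltcu|leuc].
  rewrite big1 // => i _; rewrite coefXnM ifT //.
  by rewrite (leq_ltn_trans _ ltcu) // -ltnS.
rewrite -(big_mkord xpredT (fun i => ('X^u * p)`_i)).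
rewrite (@big_cat_nat _ _ _ u) //=; last by rewrite leqW.
rewrite big_nat big1 ?add0r; last by move=> i /= ltiu; rewrite coefXnM ltiu.
rewrite -{1}[u]add0n big_addn subSn // big_mkord.
by apply: eq_bigr => i _; rewrite coefXnM addnK ltnNge leq_addl.
Qed.

(** An entry 1 contributes a factor ['X] and an entry 0 a factor 1; [u], [t] and [m] count the ones,
    the zeros and the remaining entries. Sequences cover both the full index set and the one with
    two indices removed. *)
Lemma bern_prod_three_values (R : comNzRingType) (T : eqType) (s : seq T)
    (q : T -> R) (a : R) :
  {in s, forall k, [\/ q k = 0, q k = 1 | q k = a]} ->
  exists u t m, [/\ (u + t + m)%N = size s,
    \prod_(k <- s) bern_poly (q k) = 'X^u * bern_poly a ^+ m,
    \sum_(k <- s) q k = u%:R + m%:R * a,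
    {in s, forall k, q k != 0} -> t = 0%N &
    {in s, forall k, q k != 1} -> u = 0%N].
Proof.
elim: s => [|x s IH] h.
  by exists 0%N, 0%N, 0%N; rewrite !big_nil !mul1r mul0r addr0.
have /IH [u [t [m [ss sp sq t0 u0]]]] : {in s, forall k, [\/ q k = 0, q k = 1 | q k = a]}.
  by move=> k ks; apply: h; rewrite inE ks orbT.
have sub r : {in x :: s, forall k, q k != r} -> {in s, forall k, q k != r}.
  by move=> hk k ks; apply: hk; rewrite inE ks orbT.
have nx r : q x = r -> {in x :: s, forall k, q k != r} -> False.
  by move=> <- /(_ x (mem_head _ _)); rewrite eqxx.
have [q0|n0] := eqVneq (q x) 0.
  exists u, t.+1, m; rewrite !big_cons q0 bern_poly0 mul1r add0r /= -ss.
  by split=> //; [lia|move=> /(nx _ q0)|move=> /sub].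
have [q1|n1] := eqVneq (q x) 1.
  exists u.+1, t, m; rewrite !big_cons q1 bern_poly1 sp sq /= -ss.
  split=> //; [by rewrite mulrA -exprS|by rewrite addrA nat1r|by move=> /sub|].
  by move=> /(nx _ q1).
have qa : q x = a.
  by case: (h x (mem_head _ _)) => // /eqP; rewrite ?(negbTE n0) ?(negbTE n1).
exists u, t, m.+1; rewrite !big_cons qa sp sq /= -ss.
split=> //; [lia|by rewrite mulrCA -exprS| |by move=> /sub|by move=> /sub].
by rewrite addrCA -nat1r mulrDl mul1r.
Qed.

(** * Existence of a maximiser with least sum of squares *)

(** The maximisers of [f] on [A] form a closed part of a compact set, on which [g] attains its
    minimum. *)
Lemma compact_lex_extremum (T : topologicalType) (R : realType) (f g : T -> R)
    (A : set T) :
  A !=set0 -> compact A -> continuous f -> continuous g ->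
  exists2 x, A x & forall y, A y -> f y <= f x /\ (f y = f x -> g x <= g y).
Proof.
move=> A0 cA cf cg.
have [|x xA fx] := compact_EVT_max A0 cA (f := f).
  exact: continuous_subspaceT.
rewrite inE in xA.
pose B := A `&` f @^-1` [set f x].
have clB : closed (f @^-1` [set f x]).
  by apply: preimage_closed; [move=> z _; exact: cf|exact: closed_eq].
have B0 : B !=set0 by exists x.
have cB : compact B by exact: compact_closedI.
have [|y] := compact_EVT_min B0 cB (f := g).
  exact: continuous_subspaceT.
rewrite inE => -[yA fy] gy; exists y => // z zA; rewrite [f y]fy; split.
  by apply: fx; rewrite inE.
by move=> fz; apply: gy; rewrite inE; split.
Qed.

Lemma continuous_coef_prod (T : topologicalType) (R : realType) (I : Type)
    (s : seq I) (F : I -> T -> {poly R}) k :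
  (forall i k, continuous (fun v => (F i v)`_k)) ->
  continuous (fun v => (\prod_(i <- s) F i v)`_k).
Proof.
move=> cF; elim: s k => [|i s IH] k v.
  by under eq_fun do rewrite big_nil; exact: cvg_cst.
under eq_fun do rewrite big_cons coefM.
apply: continuous_big => [|j _]; first exact: (@add_continuous R^o).
by move=> w; apply: cvgM; [exact: cF|exact: IH].
Qed.

Lemma continuous_coef_bern_poly (T : topologicalType) (R : realType) (f : T -> R) k :
  continuous f -> continuous (fun v => (bern_poly (f v))`_k).
Proof.
move=> cf w; under eq_fun do rewrite coefD coefC coefZ.
apply: cvgD; last by apply: cvgM; [exact: cf|exact: cvg_cst].
case: eqP => _; last exact: cvg_cst.
by apply: cvgB; [exact: cvg_cst|exact: cf].
Qed.

Lemma continuous_low_sum_poisson_binomial (R : realType) n c :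
  continuous (fun v : 'rV[R]_n => low_sum (poisson_binomial (v ord0)) c).
Proof.
apply: continuous_big => [|j _]; first exact: (@add_continuous R^o).
apply: continuous_coef_prod => i k.
by apply: continuous_coef_bern_poly; exact: coord_continuous.
Qed.

(** The admissible parameters form a cube cut by a hyperplane, a compact set of row vectors on which
    both objectives are continuous. *)
Lemma poisson_binomial_extremum (R : realType) n (p : 'I_n -> R) c :
  (forall i, 0 <= p i <= 1) ->
  exists q : 'I_n -> R, [/\ forall i, 0 <= q i <= 1, \sum_i q i = \sum_i p i &
   forall r : 'I_n -> R, (forall i, 0 <= r i <= 1) -> \sum_i r i = \sum_i p i ->
     low_sum (poisson_binomial r) c <= low_sum (poisson_binomial q) c /\
     (low_sum (poisson_binomial r) c = low_sum (poisson_binomial q) c ->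
      \sum_i q i ^+ 2 <= \sum_i r i ^+ 2)].
Proof.
move=> p01.
pose S (v : 'rV[R]_n) := \sum_i v ord0 i.
pose A := [set v : 'rV[R]_n | forall i, (`[0, 1]%classic : set R) (v ord0 i)]
  `&` S @^-1` [set \sum_i p i].
have cc i : continuous (fun v : 'rV[R]_n => v ord0 i) by exact: coord_continuous.
have rowE (r : 'I_n -> R) : (\row_j r j) ord0 = r by apply/funext => i; rewrite mxE.
have cS : continuous S.
  by apply: continuous_big => [|i _]; [exact: (@add_continuous R^o)|exact: cc].
have cA : compact A.
  apply: compact_closedI.
    by apply: (@rV_compact R n (fun=> `[0, 1]%classic)) => i; exact: segment_compact.
  by apply: preimage_closed; [move=> z _; exact: cS|exact: closed_eq].
have A0 : A !=set0.
  exists (\row_j p j); split=> [i|] /=; first by rewrite rowE in_itv /= p01.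
  by rewrite /S rowE.
pose g (v : 'rV[R]_n) := \sum_i v ord0 i ^+ 2.
have cg : continuous g.
  apply: continuous_big => [|i _]; first exact: (@add_continuous R^o).
  by move=> v; exact: (continuous_comp (cc i v) (@exprn_continuous _ 2 _)).
have [v [v01 Sv] hv] := compact_lex_extremum A0 cA (@continuous_low_sum_poisson_binomial R n c) cg.
exists (v ord0); split=> [//|//|r r01 Sr].
have [|h1 h2] := hv (\row_j r j).
  by split=> [i|] /=; rewrite ?/S rowE // in_itv /= r01.
by move: h1 h2; rewrite /g rowE.
Qed.

(** * Hoeffding's extremal principle *)

Definition update2 (R : Type) (n : nat) (q : 'I_n -> R) (i j : 'I_n) (x y : R)
    (k : 'I_n) : R :=
  if k == i then x else if k == j then y else q k.

(** Generic in the operation and in [F], to serve the sum, the sum of squares and the product of the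
    [bern_poly] alike. *)
Lemma big_split2 (R S : Type) (idx : S) (op : Monoid.com_law idx) (n : nat)
    (q : 'I_n -> R) (i j : 'I_n) (F : R -> S) : i != j ->
  \big[op/idx]_k F (q k) =
  op (F (q i)) (op (F (q j)) (\big[op/idx]_(k | (k != i) && (k != j)) F (q k))).
Proof. by move=> ij; rewrite (bigD1 i) //= (bigD1 j) //= eq_sym. Qed.

Lemma big_update2 (R S : Type) (idx : S) (op : Monoid.com_law idx) (n : nat)
    (q : 'I_n -> R) (i j : 'I_n) (x y : R) (F : R -> S) : i != j ->
  \big[op/idx]_k F (update2 q i j x y k) =
  op (F x) (op (F y) (\big[op/idx]_(k | (k != i) && (k != j)) F (q k))).
Proof.
move=> ij; rewrite (@big_split2 _ _ _ _ _ _ i j) //.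
rewrite {1 2}/update2 eqxx eq_sym (negbTE ij) eqxx; congr (op _ (op _ _)).
by apply: eq_bigr => k /andP[/negbTE ki /negbTE kj]; rewrite /update2 ki kj.
Qed.


(** The coefficient in the conclusion is the slope of the objective in the product of the two
    entries. Unequal entries survive at a maximiser only if this slope is negative and the product
    cannot be lowered, one entry being stuck at an end of [0, 1]. *)
Lemma extremal_pair (R : realType) n (q : 'I_n -> R) c (i j : 'I_n) :
  (forall i, 0 <= q i <= 1) ->
  (forall r : 'I_n -> R, (forall i, 0 <= r i <= 1) -> \sum_i r i = \sum_i q i ->
     low_sum (poisson_binomial r) c <= low_sum (poisson_binomial q) c /\
     (low_sum (poisson_binomial r) c = low_sum (poisson_binomial q) c ->
      \sum_i q i ^+ 2 <= \sum_i r i ^+ 2)) ->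
  q i < q j ->
  ((1 - 'X) * \prod_(k | (k != i) && (k != j)) bern_poly (q k))`_c < 0 /\
  (q i = 0 \/ q j = 1).
Proof.
move=> q01 hq qij.
have ij : i != j by apply: contraTneq qij => ->; rewrite ltxx.
set H := \prod_(k | _) _; set C := ((1 - 'X) * H)`_c.
(* Maximality and the tie-break, expressed through the change of the product when the two entries
   move with their sum fixed. *)
have step x y : 0 <= x <= 1 -> 0 <= y <= 1 -> x + y = q i + q j ->
    (x * y - q i * q j) * C <= 0 /\
    ((x * y - q i * q j) * C = 0 -> q i ^+ 2 + q j ^+ 2 <= x ^+ 2 + y ^+ 2).
  move=> x01 y01 exy; have [k||] := hq (update2 q i j x y).
  - by rewrite /update2; case: ifP => _ //; case: ifP.
  - have -> := @big_update2 R R 0 +%R _ q i j x y (fun z => z) ij.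
    have -> := @big_split2 R R 0 +%R _ q i j (fun z => z) ij.
    by rewrite /= !addrA exy.
  have -> := @big_update2 R R 0 +%R _ q i j x y (fun z => z ^+ 2) ij.
  have -> := @big_split2 R R 0 +%R _ q i j (fun z => z ^+ 2) ij.
  have -> : poisson_binomial (update2 q i j x y) = bern_poly x * (bern_poly y * H).
    exact: big_update2.
  have -> : poisson_binomial q = bern_poly (q i) * (bern_poly (q j) * H).
    exact: big_split2.
  have E := low_sum_spread H c exy.
  move=> h1 h2; rewrite -E; split=> [|E0]; first by rewrite subr_le0.
  by have := h2 (subr0_eq E0); rewrite /= !addrA lerD2r.
have /andP[qi0 qi1] := q01 i; have /andP[qj0 qj1] := q01 j.
(* Otherwise averaging [q i] and [q j] would not decrease the objective and would
   decrease the sum of squares. *)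
have C0 : C < 0.
  rewrite ltNge; apply/negP => C0.
  have m01 : 0 <= (q i + q j) / 2 <= 1 by apply/andP; split; lra.
  have [|h1 h2] := step _ _ m01 m01; first by field.
  have E : (q i + q j) / 2 * ((q i + q j) / 2) - q i * q j = ((q i - q j) / 2) ^+ 2 by field.
  rewrite E in h1 h2.
  have /eqP/h2 : ((q i - q j) / 2) ^+ 2 * C == 0.
    by rewrite eq_le h1 mulr_ge0 // sqr_ge0.
  have : 0 < (q i - q j) ^+ 2 by rewrite exprn_even_gt0 //= subr_eq0 lt_eqF.
  nra.
split=> //; have [|qi] := eqVneq (q i) 0; [by left|right].
apply/eqP; apply: contraT => qj.
(* Spreading [q i] and [q j] apart would increase the objective. *)
have [e [e0 ei ej]] : exists e, [/\ 0 < e, e <= q i & e <= 1 - q j].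
  exists (Num.min (q i) (1 - q j)); rewrite lt_min !lt_def qi qi0 subr_ge0 qj1.
  by rewrite subr_eq0 eq_sym qj /= !ge_min !lexx orbT.
have [|||h1 _] := step (q i - e) (q j + e).
- by apply/andP; split; lra.
- by apply/andP; split; lra.
- by rewrite addrACA addNr addr0.
exfalso; move: h1; apply/negP; rewrite -ltNge nmulr_rgt0 //.
nra.
Qed.

(** The first alternative is a maximiser made of zeros and ones only; in the second, [s] counts its
    ones and [a] is its common value inside (0, 1). *)
Lemma poisson_binomial_le_binomial (R : realType) n (p : 'I_n -> R) c :
  (forall i, 0 <= p i <= 1) -> c%:R < \sum_i p i ->
  low_sum (poisson_binomial p) c <= 0 \/
  exists s a, [/\ (s <= n)%N, 0 < a < 1, \sum_i p i = s%:R + (n - s)%:R * a,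
    low_sum (poisson_binomial p) c <= low_sum ('X^s * bern_poly a ^+ (n - s)) c &
    c.+1%:R < \sum_i p i -> s = 0%N].
Proof.
move=> p01 hc.
have [q [q01 qp hq]] := poisson_binomial_extremum c p01.
have [hp _] := hq p p01 erefl.
have {hq} pair i j : q i < q j ->
  ((1 - 'X) * \prod_(k | (k != i) && (k != j)) bern_poly (q k))`_c < 0 /\
  (q i = 0 \/ q j = 1).
  by apply: extremal_pair => // r r01 Er; apply: hq => //; rewrite Er.
(* If every entry is 0 or 1, the sum is the constant number of ones, which exceeds [c], so the lower
   tail is 0. *)
have [[i /andP[qi0 qi1]]|no] := pselect (exists i, 0 < q i < 1); last first.
  left; apply: (le_trans hp).
  have [k _|u [t [m [_ pE sE _ _]]]] := @bern_prod_three_values _ _ (index_enum 'I_n) q 0.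
    have [q0|n0] := eqVneq (q k) 0; first by constructor 1.
    have [q1|n1] := eqVneq (q k) 1; first by constructor 2.
    have /andP[k0 k1] := q01 k.
    by case: no; exists k; rewrite !lt_def n0 k0 eq_sym n1.
  rewrite /poisson_binomial pE bern_poly0 expr1n low_sumXnM.
  by move: hc; rewrite -qp sE mulr0 addr0 ltr_nat => ->.
have val k : [\/ q k = 0, q k = 1 | q k = q i].
  have [lt|lt|->] := ltgtP (q k) (q i); last by constructor 3.
    by have [_ [->|q1]] := pair _ _ lt; [constructor 1|rewrite q1 ltxx in qi1].
  by have [_ [q1|->]] := pair _ _ lt; [rewrite q1 ltxx in qi0|constructor 2].
(* [m] counts copies of [q i] other than the one at [i], hence [m.+1] in the sum, the form in which
   [coef_1subX_bern_ge0] takes its bound. *)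
have rest z : z != i -> exists u m,
    \prod_(k | (k != z) && (k != i)) bern_poly (q k) = 'X^u * bern_poly (q i) ^+ m
    /\ \sum_i p i = q z + (u%:R + m.+1%:R * q i).
  move=> zi; have [k _|u [t [m [_ pE sE _ _]]]] := @bern_prod_three_values _ _
    [seq k <- index_enum 'I_n | (k != z) && (k != i)] q (q i); first exact: val.
  rewrite !big_filter in pE sE; exists u, m; split=> //.
  rewrite -qp (bigD1 z) //= (bigD1 i) 1?eq_sym //= sE -nat1r; ring.
(* A zero paired with [i] would need a negative slope, while the mean condition puts [c] at or below
   the mode of the other variables. *)
have no0 k : q k != 0.
  apply/negP => /eqP qk; have ki : q k < q i by rewrite qk.
  have [|u [m [pE sE]]] := rest k; first by apply: contraTneq ki => ->; rewrite ltxx.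
  have [] := pair _ _ ki; rewrite pE ltNge coef_1subX_bern_ge0 ?qi0 //.
  by move: hc; rewrite sE qk add0r.
right; have [k _|u [t [m [sz pE sE t0 u0]]]] := @bern_prod_three_values _ _
  (index_enum 'I_n) q (q i); first exact: val.
move: sz; rewrite {}t0 // addn0 -sum1_size sum1_card card_ord => sz.
exists u, (q i); have -> : (n - u = m)%N by rewrite -sz addKn.
rewrite -[X in (u <= X)%N]sz leq_addr qi0 qi1 -qp; split=> //.
  by rewrite -pE.
(* The same for a one paired with [i]: it takes 1 off the sum, whence the stronger bound with
   [c.+1]. *)
move=> hc1; apply: u0 => k _; apply/negP => /eqP qk.
have ik : q i < q k by rewrite qk.
have [|v [l [pE' sE']]] := rest k; first by apply: contraTneq ik => ->; rewrite ltxx.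
have [] := pair _ _ ik; under eq_bigl do rewrite andbC.
rewrite pE' ltNge coef_1subX_bern_ge0 ?qi0 //.
by move: hc1; rewrite qp sE' qk -natr1; lra.
Qed.

(** * Incomplete Beta functions at integer parameters *)

(** The binomial distribution function as a polynomial in the success probability, ready for
    differentiation. *)
Definition binomial_cdf (R : comNzRingType) (N k : nat) : {poly R} :=
  \sum_(j < k.+1) 'C(N, j)%:R *: ('X^j * (1 - 'X) ^+ (N - j)).

Lemma horner_binomial_cdf (R : comNzRingType) N k (x : R) :
  (binomial_cdf R N k).[x] = low_sum (bern_poly x ^+ N) k.
Proof.
rewrite /binomial_cdf /low_sum horner_sum; apply: eq_bigr => i _.
by rewrite coef_bern_polyX !hornerE ?mulrA.
Qed.

(** The derivatives of consecutive terms telescope; minus the Beta density with parameters k + 1 and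
    N - k + 1 remains. *)
Lemma deriv_binomial_cdf (R : comNzRingType) N k : (k <= N)%N ->
  (binomial_cdf R N.+1 k)^`() =
  - ((N.+1 * 'C(N, k))%:R *: ('X^k * (1 - 'X) ^+ (N - k))).
Proof.
elim: k => [|k IH] lekN.
  rewrite /binomial_cdf big_ord1 !bin0 !subn0 !expr0 !mul1r scale1r muln1.
  rewrite deriv_exp derivB derivX derivC sub0r mulN1r mulNrn /=.
  by rewrite -scaler_nat.
rewrite /binomial_cdf big_ord_recr /= derivD -/(binomial_cdf R N.+1 k) IH ?(ltnW lekN) //.
rewrite subSS derivZ derivM derivXn deriv_exp derivB derivX derivC sub0r.
have -> : (N - k = (N - k.+1).+1)%N by rewrite subnSK.
have E1 : (N.+1 * 'C(N, k) = k.+1 * 'C(N.+1, k.+1))%N by rewrite mul_bin_diag.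
have E2 : (N.+1 * 'C(N, k.+1) = (N - k.+1).+1 * 'C(N.+1, k.+1))%N.
  by rewrite (mul_bin_down N.+1 k.+1) subSS -subnSK.
rewrite !scaler_nat E1 E2 !mulrnA /= mulrnAl mulN1r mulNrn mulrN mulrnAr.
by rewrite mulrnDl addrA addNr add0r mulNrn.
Qed.

(* [- gamma_poly m * exp(-x)] is an antiderivative of [x ^+ m * exp(-x)]. *)
Fixpoint gamma_poly (R : comNzRingType) (m : nat) : {poly R} :=
  if m is k.+1 then 'X^(k.+1) + k.+1%:R *: gamma_poly R k else 1.

Lemma deriv_gamma_poly (R : comNzRingType) m :
  (gamma_poly R m)^`() = gamma_poly R m - 'X^m.
Proof.
elim: m => [|m IH] /=; first by rewrite derivC subrr.
by rewrite derivD derivXn derivZ IH /= scalerBr !scaler_nat addrC subrK [RHS]addrAC subrr add0r.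
Qed.

Lemma gamma_poly0 (R : comNzRingType) m : (gamma_poly R m).[0] = m`!%:R.
Proof.
elim: m => [|m IH] /=; first by rewrite hornerC.
by rewrite hornerD hornerXn hornerZ IH expr0n /= add0r -natrM.
Qed.

(** Squeezed below (m+1)!/x, because exp(x) >= x^(m+1)/(m+1)!. *)
Lemma cvg_exprn_expRN (R : realType) m :
  x ^+ m * expR (- x) @[x --> +oo] --> (0 : R).
Proof.
apply: (@squeeze_cvgr _ _ _ _ (fun=> 0) (fun x => m.+1`!%:R * x^-1)); last 2 first.
- exact: cvg_cst.
- rewrite -[X in _ --> X](mulr0 m.+1`!%:R); apply: cvgM; first exact: cvg_cst.
  by apply/(gtr0_cvgV0 (f := id)); [exact: nbhs_pinfty_gt|exact: cvg_id].
near=> x.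
have x0 : 0 < x by near: x; exact: nbhs_pinfty_gt.
apply/andP; split; first by rewrite mulr_ge0 ?expR_ge0 // exprn_ge0 // ltW.
rewrite expRN ler_pdivrMr ?expR_gt0 // mulrAC ler_pdivlMr // -exprSr.
rewrite -ler_pdivrMl ?ltr0n ?fact_gt0 // mulrC.
by apply: le_trans (expR_ge1Dxn m (ltW x0)); rewrite lerDr.
Unshelve. all: by end_near. Qed.

Lemma cvg_gamma_poly_expRN (R : realType) m :
  (gamma_poly R m).[x] * expR (- x) @[x --> +oo] --> (0 : R).
Proof.
elim: m => [|m IH] /=.
  by under eq_fun do rewrite hornerC; exact: (@cvg_exprn_expRN R 0).
under eq_fun do rewrite hornerD hornerXn hornerZ mulrDl -mulrA.
have h := cvgD (@cvg_exprn_expRN R m.+1) (cvgM (cvg_cst (m.+1%:R : R)) IH).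
by rewrite mulr0 addr0 in h; exact: h.
Qed.

Lemma Gamma_nat (R : realType) m : Gamma (m.+1%:R : R) = m`!%:R.
Proof.
rewrite /Gamma.
transitivity (\int[lebesgue_measure]_(t in `[0, +oo[) (t ^+ m * expR (- t)) : R).
  apply: eq_Rintegral => t; rewrite inE /= in_itv /= andbT => t0.
  by rewrite -natr1 addrK powR_mulrn.
have dF x : is_derive x (1 : R) (fun t => - ((gamma_poly R m).[t] * expR (- t)))
    (x ^+ m * expR (- x)).
  have h := is_deriveN (is_deriveM (is_derive_poly (gamma_poly R m) x)
    (is_derive1_comp (is_derive_expR (- x)) (is_deriveNid x 1))).
  apply: (is_derive_eq h).
  rewrite deriv_gamma_poly hornerD hornerN hornerXn /= /GRing.scale /=; ring.
rewrite (@Rintegral_ge0_continuous_FTC2y _ _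
  (fun t => - ((gamma_poly R m).[t] * expR (- t))) _ 0).
- by rewrite oppr0 expR0 mulr1 gamma_poly0 sub0r opprK.
- by move=> x x0; rewrite mulr_ge0 ?exprn_ge0 ?expR_ge0.
- apply: continuous_subspaceT => x; apply: cvgM; first exact: exprn_continuous.
  by apply: continuous_comp; [exact: opp_continuous|exact: continuous_expR].
- by rewrite -oppr0; apply: cvgN; exact: cvg_gamma_poly_expRN.
- by move=> x _; exact: ex_derive.
- apply: cvg_at_right_filter; have d0 := @ex_derive _ _ _ _ _ _ _ (dF 0).
  by move/derivable1_diffP/differentiable_continuous : d0; exact.
- by move=> x _; rewrite derive1E derive_val.
Qed.

Lemma binomial_cdf0 (R : comNzRingType) N k : (binomial_cdf R N k).[0] = 1.
Proof.
rewrite horner_binomial_cdf bern_poly0 expr1n /low_sum big_ord_recl big1 ?coef1 ?addr0 //.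
by move=> i _; rewrite coef1.
Qed.

Lemma binomial_cdf1 (R : comNzRingType) N k : (k < N)%N -> (binomial_cdf R N k).[1] = 0.
Proof.
move=> ltkN; rewrite horner_binomial_cdf bern_poly1 /low_sum big1 // => i _.
by rewrite coefXn ltn_eqF // (leq_trans (ltn_ord i)).
Qed.

(** The normalised Beta density is minus the derivative of [binomial_cdf], whose value at 0 is 1.
    Thus I_x(k+1, N-k) is the probability of more than k successes in N trials. *)
Lemma inc_beta_nat (R : realType) N k (x : R) : (k < N)%N -> 0 <= x <= 1 ->
  inc_beta x (k + 1)%:R (N - k)%:R = 1 - (binomial_cdf R N k).[x].
Proof.
case: N => // N; rewrite ltnS => lekN /andP[x0 x1].
rewrite /inc_beta subSn // addn1 -natrD addnS addSn subnKC //.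
rewrite !Gamma_nat.
transitivity (N.+1`!%:R / (k`!%:R * (N - k)`!%:R) *
    \int[lebesgue_measure]_(t in `[0, x]) (t ^+ k * (1 - t) ^+ (N - k)) : R).
  congr (_ * _); apply: eq_Rintegral => t; rewrite inE /= in_itv /= => /andP[t0 tx].
  by rewrite -!natr1 !addrK !powR_mulrn // subr_ge0 (le_trans tx).
move: x0; rewrite le_eqVlt => /predU1P[<-|x0].
  by rewrite set_itv1 Rintegral_set1 mulr0 binomial_cdf0 subrr.
pose K : R := (N.+1 * 'C(N, k))%:R.
have K0 : K != 0 by rewrite pnatr_eq0 muln_eq0 /= -lt0n bin_gt0.
have -> : N.+1`!%:R / (k`!%:R * (N - k)`!%:R) = K.
  rewrite /K factS -(bin_fact lekN) !natrM; field.
  by rewrite !pnatr_eq0 -!lt0n !fact_gt0.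
rewrite /Rintegral (@continuous_FTC2 _ _ (fun t => - K^-1 * (binomial_cdf R N.+1 k).[t])) //=.
- by rewrite binomial_cdf0 -mulrBr mulNr mulrN mulrA divff // mul1r opprB.
- apply: continuous_subspaceT => t; apply: cvgM; first exact: exprn_continuous.
  exact: continuous_onemXn.
- split=> [t _||].
  + by apply: derivableM; [exact: derivable_cst|exact: derivable_horner].
  + by apply: cvg_at_right_filter; apply: cvgM; [exact: cvg_cst|exact: continuous_horner].
  + by apply: cvg_at_left_filter; apply: cvgM; [exact: cvg_cst|exact: continuous_horner].
- move=> t _; rewrite derive1Ml; last exact: derivable_horner.
  by rewrite -derivE deriv_binomial_cdf // !hornerE -/K mulNr mulrN opprK ?mulrA mulVf // mul1r.
Qed.

Lemma binomial_cdf_decr (R : realType) N k : (k < N)%N ->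
  {in `[0, 1]%R &, {homo (fun x : R => (binomial_cdf R N k).[x]) : x y /~ x < y}}.
Proof.
case: N => // N; rewrite ltnS => lekN; apply: ltr0_derive1_lt_cc.
- by move=> x _; exact: derivable_horner.
- move=> x; rewrite in_itv /= => /andP[x0 x1].
  rewrite -derivE deriv_binomial_cdf // !hornerE oppr_lt0.
  rewrite !mulr_gt0 ?exprn_gt0 ?subr_gt0 // ltr0n muln_gt0 /= bin_gt0 //.
- by apply: continuous_subspaceT; exact: continuous_horner.
Qed.

(** The distribution function falls continuously from 1 to 0, so by the intermediate value theorem
    [xget] finds a genuine solution and not its default. *)
Lemma inc_beta_invP (R : realType) N k (alpha : R) : (k < N)%N -> 0 <= alpha <= 1 ->
  0 <= inc_beta_inv alpha (k + 1)%:R (N - k)%:R <= 1 /\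
  (binomial_cdf R N k).[inc_beta_inv alpha (k + 1)%:R (N - k)%:R] = 1 - alpha.
Proof.
move=> ltkN /andP[a0 a1].
suff : [set x : R | 0 <= x <= 1 /\ inc_beta x (k + 1)%:R (N - k)%:R = alpha] !=set0.
  case=> x Ax; have := xgetPex 0 (ex_intro _ x Ax).
  rewrite -/(inc_beta_inv _ _ _) /= => -[h]; rewrite inc_beta_nat // => e.
  by split=> //; lra.
have [||x x01 ex] := @IVT R (fun x => (binomial_cdf R N k).[x]) 0 1 (1 - alpha) ler01.
- by apply: continuous_subspaceT; exact: continuous_horner.
- by rewrite binomial_cdf0 binomial_cdf1 // min_r ?max_l ?ler01 //; apply/andP; split; lra.
rewrite in_itv /= in x01; exists x; split=> //.
by rewrite inc_beta_nat // ex opprB addrC subrK.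
Qed.

(** * The law of the number of ones *)

Definition num_true (n : nat) (b : {ffun 'I_n -> bool}) : nat := (\sum_i b i)%N.

Definition weight (R : nzRingType) (n : nat) (q : 'I_n -> R)
    (b : {ffun 'I_n -> bool}) : R :=
  \prod_i (if b i then q i else 1 - q i).

(** The law of the number of ones as a finite sum over outcome vectors, free of the probability
    space. *)
Definition count_law (R : nzRingType) (n : nat) (q : 'I_n -> R) (A : pred nat) : R :=
  \sum_(b : {ffun 'I_n -> bool} | A (num_true b)) weight q b.

Lemma num_true_le n (b : {ffun 'I_n -> bool}) : (num_true b <= n)%N.
Proof. by rewrite -[leqRHS]card_ord -sum1_card leq_sum // => i _; case: (b i). Qed.

Lemma weight_ge0 (R : numDomainType) n (q : 'I_n -> R) b :
  (forall i, 0 <= q i <= 1) -> 0 <= weight q b.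
Proof.
by move=> q01; apply: prodr_ge0 => i _; have /andP[? ?] := q01 i; case: ifP; rewrite ?subr_ge0.
Qed.

Lemma count_law_le (R : numDomainType) n (q : 'I_n -> R) (A B : pred nat) :
  (forall i, 0 <= q i <= 1) -> (forall k, (k <= n)%N -> A k -> B k) ->
  count_law q A <= count_law q B.
Proof.
move=> q01 AB; rewrite /count_law big_mkcond [leRHS]big_mkcond /=.
apply: ler_sum => b _; have := AB _ (num_true_le b).
by case: (A _) => [->//|_]; case: (B _) => //; exact: weight_ge0.
Qed.

Lemma eq_count_law (R : nzRingType) n (q : 'I_n -> R) (A B : pred nat) :
  (forall k, (k <= n)%N -> A k = B k) -> count_law q A = count_law q B.
Proof. by move=> AB; apply: eq_bigl => b; apply: AB; exact: num_true_le. Qed.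

Lemma count_lawC (R : comNzRingType) n (q : 'I_n -> R) (A : pred nat) :
  count_law q (predC A) = 1 - count_law q A.
Proof.
have : \sum_b weight q b = 1.
  rewrite -(bigA_distr_bigA (fun i (x : bool) => if x then q i else 1 - q i)) big1 // => i _.
  by rewrite big_bool /= addrC subrK.
by rewrite /count_law (bigID (fun b => A (num_true b))) /= => <-; rewrite addrAC subrr add0r.
Qed.

(** Flipping every outcome is an involution that exchanges [q i] with [1 - q i] and [k] with
    [n - k]. *)
Lemma count_law_compl (R : comNzRingType) n (q : 'I_n -> R) (A : pred nat) :
  count_law (fun i => 1 - q i) A = count_law q (fun k => A (n - k)%N).
Proof.
pose h (b : {ffun 'I_n -> bool}) := [ffun i => ~~ b i].
have hK : involutive h by move=> b; apply/ffunP => i; rewrite !ffunE negbK.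
rewrite /count_law (reindex_inj (inv_inj hK)) /=; apply: eq_big => b.
  congr (A _); rewrite -[X in (X - _)%N]card_ord -sum1_card -sumnB.
    by apply: eq_bigr => i _; rewrite ffunE; case: (b i).
  by move=> i _; case: (b i).
by move=> _; apply: eq_bigr => i _; rewrite ffunE; case: (b i) => //=; rewrite opprB addrC subrK.
Qed.

(** Expanding the product over all choices of 0 or 1 places the weight of each outcome at the power
    given by its number of ones. *)
Lemma count_law_leE (R : comNzRingType) n (q : 'I_n -> R) c :
  count_law q (fun k => (k <= c)%N) = low_sum (poisson_binomial q) c.
Proof.
have -> : poisson_binomial q = \sum_b weight q b *: 'X^(num_true b).
  rewrite /poisson_binomial.
  under eq_bigr => i _.
    have -> : bern_poly (q i) = \sum_(x : bool) (if x then q i else 1 - q i) *: 'X^x.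
      by rewrite big_bool /= alg_polyC addrC.
    over.
  rewrite bigA_distr_bigA; apply: eq_bigr => b _.
  by rewrite scaler_prod prodrXr.
rewrite /low_sum; under [RHS]eq_bigr do rewrite coef_sum.
rewrite exchange_big /count_law big_mkcond; apply: eq_bigr => b _ /=.
under eq_bigr do rewrite coefZ coefXn mulr_natr mulrb.
by rewrite -big_mkcond (big_ord1_eq _ (fun=> weight q b)).
Qed.

Lemma low_sum_bern_compl (R : comNzRingType) n d (a : R) : (d < n)%N ->
  low_sum (bern_poly (1 - a) ^+ n) (n - d - 1) = 1 - low_sum (bern_poly a ^+ n) d.
Proof.
move=> ltdn; have E (x : R) c :
    low_sum (bern_poly x ^+ n) c = count_law (fun _ : 'I_n => x) (fun k => (k <= c)%N).
  by rewrite count_law_leE /poisson_binomial prodr_const card_ord.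
rewrite !E (count_law_compl (fun=> a)) -count_lawC; apply: eq_count_law => k lekn /=.
lia.
Qed.

(** * Averages and the bound on the failure probability *)

Lemma average_compl (R : realType) n (q : 'I_n -> R) : (0 < n)%N ->
  average (fun i => 1 - q i) = 1 - average q.
Proof.
move=> n0; rewrite /average sumrB sumr_const card_ord mulrBl divff //.
by rewrite pnatr_eq0 -lt0n.
Qed.

Lemma sum_average (R : realType) n (q : 'I_n -> R) : (0 < n)%N ->
  \sum_i q i = n%:R * average q.
Proof. by move=> n0; rewrite /average mulrC divfK // pnatr_eq0 -lt0n. Qed.

Lemma average_itv01 (R : realType) n (q : 'I_n -> R) : (0 < n)%N ->
  (forall i, 0 <= q i <= 1) -> 0 <= average q <= 1.
Proof.
move=> n0 q01; rewrite /average divr_ge0 //=; last first.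
  by apply: sumr_ge0 => i _; have /andP[] := q01 i.
rewrite ler_pdivrMr ?ltr0n // mul1r -[n in leRHS]card_ord -sum1_card natr_sum.
by apply: ler_sum => i _; have /andP[] := q01 i.
Qed.

Lemma S_at_le_S_max (R : realType) n c (alpha : R) s : (s <= c)%N ->
  S_at n c alpha s <= S_max n c alpha.
Proof.
move=> lesc; rewrite /S_max big_mkord.
exact: (le_bigmax _ _ (Ordinal (lesc : (s < c.+1)%N))).
Qed.

Lemma count_law_gt_le_alpha (R : realType) n (q : 'I_n -> R) (alpha : R) d :
  (forall i, 0 <= q i <= 1) -> 0 <= alpha <= 1 -> (d < n)%N ->
  average q < f_tilde alpha d n ->
  count_law q (fun k => (d < k)%N) <= alpha.
Proof.
move=> q01 /andP[a0 a1] ltdn hq.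
have n0 : (0 < n)%N by apply: leq_ltn_trans ltdn.
have a01 : 0 <= 1 - alpha <= 1 by apply/andP; split; lra.
pose r i := 1 - q i.
have r01 i : 0 <= r i <= 1.
  by have /andP[? ?] := q01 i; rewrite /r; apply/andP; split; lra.
have [c Ec] : exists c, (n - d - 1)%N = c by exists (n - d - 1)%N.
have Ec1 : (c.+1 = n - d)%N by rewrite -Ec subn1 prednK // subn_gt0.
have -> : count_law q (fun k => (d < k)%N) = low_sum (poisson_binomial r) c.
  rewrite -count_law_leE count_law_compl; apply: eq_count_law => k lekn; lia.
have sr : \sum_i r i = n%:R * (1 - average q) by rewrite -average_compl // -sum_average.
have ltcn : (c < n)%N by rewrite Ec1 leq_subr.
have nR : (0 : R) < n%:R by rewrite ltr0n.
move: hq; rewrite /f_tilde; case: ifP => [_|]; rewrite ?Ec; last first.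
  move=> /negbT; rewrite -leNgt /alpha_dagger => hdag hq.
  have [] := inc_beta_invP ltdn (introT andP (conj a0 a1)).
  move: hq; set x := inc_beta_inv _ _ _ => hq /andP[x0 x1] hx.
  have dn01 : 0 <= (d%:R / n%:R : R) <= 1.
    by rewrite divr_ge0 // ler_pdivrMr // mul1r ler_nat ltnW.
  have /andP[v0 v1] := average_itv01 n0 q01.
  (* This is where alpha <= alpha_dagger enters: the average lies below d/n, so the sum of the [r i]
     exceeds c + 1 and the extremal law has no ones. *)
  have lexd : x <= d%:R / n%:R.
    rewrite leNgt; apply/negP => ltdx.
    have := @binomial_cdf_decr R n d ltdn x (d%:R / n%:R); rewrite !in_itv /= x0 x1 dn01.
    move=> /(_ isT isT ltdx); rewrite hx; move: hdag; rewrite inc_beta_nat //; lra.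
  have hc1 : c.+1%:R < \sum_i r i.
    have -> : c.+1%:R = n%:R - d%:R :> R.
      by rewrite -natrB 1?ltnW //; rewrite Ec1.
    rewrite sr; have : average q * n%:R < d%:R by rewrite -ltr_pdivlMr //; exact: lt_le_trans lexd.
    lra.
  have hc : c%:R < \sum_i r i by apply: le_lt_trans hc1; rewrite ler_nat.
  have [h|[s [a [lesn _ es hp /(_ hc1) s0]]]] := poisson_binomial_le_binomial r01 hc.
    exact: le_trans h a0.
  (* With s = 0 the common value [a] is [1 - average q], and exchanging successes and failures leads
     back to [x]. *)
  move: es hp; rewrite {}s0 subn0 expr0 mul1r add0r sr => /(mulfI (lt0r_neq0 nR)) <-.
  move=> /le_trans; apply; rewrite -Ec low_sum_bern_compl // -horner_binomial_cdf.
  have := @binomial_cdf_decr R n d ltdn x (average q); rewrite !in_itv /= x0 x1 v0 v1.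
  move=> /(_ isT isT hq); rewrite hx; lra.
move=> hq.
have hS s : (s <= c)%N -> n%:R * S_at n c alpha s < \sum_i r i.
  move=> lesc; rewrite sr ltr_pM2l // (le_lt_trans (S_at_le_S_max n alpha lesc)) //; lra.
(* Writing n - c as (n-s) - (c-s) makes the quantile that of a binomial law with n - s trials and
   threshold c - s. *)
have SE s : (s <= c)%N -> n%:R * S_at n c alpha s =
    s%:R + (n - s)%:R * inc_beta_inv (1 - alpha) (c - s + 1)%:R ((n - s) - (c - s))%:R.
  move=> lesc; have E : (n - s - (c - s) = n - c)%N by lia.
  by rewrite E /S_at [LHS]mulrC divfK ?lt0r_neq0.
(* The term s = c of the maximum alone yields this bound. *)
have hc : c%:R < \sum_i r i.
  apply: le_lt_trans (hS c (leqnn c)); rewrite SE // lerDl mulr_ge0 //.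
  by have [|/andP[]] := @inc_beta_invP R (n - c) (c - c) (1 - alpha) _ a01;
    rewrite ?subnn ?subn_gt0.
have [h|[s [a [lesn /andP[b0 b1] es hp _]]]] := poisson_binomial_le_binomial r01 hc.
  exact: le_trans h a0.
apply: (le_trans hp); rewrite low_sumXnM; case: ltnP => // lesc.
have lt1 : (c - s < n - s)%N by rewrite ltn_sub2rE.
have [] := inc_beta_invP lt1 a01; set x := inc_beta_inv _ _ _ => /andP[x0 x1] hx.
(* The term of the maximum at the extremal [s] has the same number of ones as the maximiser, so
   comparing sums compares [x] with [a]. *)
have ltxa : x < a.
  by have := hS s lesc; rewrite SE // es ltrD2l ltr_pM2l // ltr0n subn_gt0 (leq_ltn_trans lesc).
rewrite -horner_binomial_cdf.
have := @binomial_cdf_decr R _ _ lt1 a x; rewrite !in_itv /= x0 x1 (ltW b0) (ltW b1).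
move=> /(_ isT isT ltxa); rewrite hx; lra.
Qed.

Lemma count_law_ge_q_hat (R : realType) n (q : 'I_n -> R) (alpha : R) :
  (0 < n)%N -> (forall i, 0 <= q i <= 1) -> 0 <= alpha <= 1 ->
  1 - alpha <= count_law q (fun k => q_hat alpha k n <= average q).
Proof.
move=> n0 q01 a01.
pose bad k := (k <= n)%N && ~~ (q_hat alpha k n <= average q).
suff : count_law q bad <= alpha.
  have -> : count_law q bad = count_law q (predC (fun k => q_hat alpha k n <= average q)).
    by apply: eq_count_law => k lekn; rewrite /bad lekn.
  rewrite count_lawC; lra.
have [exb|nob] := pselect (exists k, bad k); last first.
  rewrite /count_law big_pred0 => [|b]; first by have /andP[] := a01.
  by apply/negP => hb; apply: nob; exists (num_true b).
(* The count 0 is never bad, since [q_hat] vanishes there; the least bad count is thus some [d.+1],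
   and all bad counts exceed [d]. *)
case: (ex_minnP exb) => -[|d] /andP[ledn hd] hmin.
  by move: hd; rewrite /q_hat /=; have /andP[->] := average_itv01 n0 q01.
apply: (@le_trans _ _ (count_law q (fun k => (d < k)%N))).
  by apply: count_law_le => // k _; exact: hmin.
apply: count_law_gt_le_alpha => //.
by move: hd; rewrite -ltNge /q_hat intS addrAC subrr add0r.
Qed.

(** * Transfer to the probability space *)

(** The event is a finite disjoint union over outcome vectors, each of which has the product weight
    by independence. *)
Lemma probability_count_ones (R : realType) (disp : measure_display)
    (Omega : measurableType disp) (P : probability Omega R) (n : nat)
    (T : 'I_n -> {RV P >-> bool}) (q : 'I_n -> R) (A : pred nat) :
  (forall i, P [set w | T i w = true] = (q i)%:E) -> mutually_independent T ->
  P [set w | A (count_ones T w)] = (count_law q A)%:E.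
Proof.
move=> hT hind.
have mT i (B : set bool) : measurable (T i @^-1` B) by exact: measurable_funPTI.
have PT i x : P (T i @^-1` [set x]) = (if x then q i else 1 - q i)%:E.
  case: x; first exact: hT.
  have -> : T i @^-1` [set false] = ~` (T i @^-1` [set true]).
    by apply/seteqP; split=> w /=; case: (T i w).
  by rewrite probability_setC // hT.
pose F (b : {ffun 'I_n -> bool}) :=
  \bigcap_(i in [set i : 'I_n | i \in [set: 'I_n]%SET]) T i @^-1` [set b i].
have PF b : P (F b) = (weight q b)%:E.
  rewrite (hind [set: 'I_n]%SET (fun i => [set b i])); under eq_bigr do rewrite PT.
  by rewrite prodEFin /weight; congr (_%:E); apply: eq_bigl => i; rewrite finset.in_setT.
pose s := [seq b <- index_enum {ffun 'I_n -> bool} | A (num_true b)].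
have us : uniq s by rewrite filter_uniq // index_enum_uniq.
have -> : [set w | A (count_ones T w)] = \bigcup_(b in [set` s]) F b.
  apply/seteqP; split=> [w /= Aw|w [b /= bs Fb]].
    exists [ffun i => T i w] => [|i _ /=]; last by rewrite ffunE.
    rewrite /= mem_filter mem_index_enum andbT /num_true.
    by under eq_bigr do rewrite ffunE.
  move: bs; rewrite mem_filter => /andP[Ab _].
  congr (is_true (A _)): Ab; apply: eq_bigr => i _; congr nat_of_bool.
  by rewrite [T i w](Fb i _) //= finset.in_setT.
rewrite measure_fin_bigcup //; last 2 first.
- move=> b c _ _ [w [/= wb wc]]; apply/ffunP => i.
  by rewrite -(wb i) ?(wc i) //= finset.in_setT.
- by move=> b _; apply: fin_bigcap_measurable => // i _; exact: mT.
rewrite -fsbig_seq // big_filter /count_law -sumEFin.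
by apply: eq_bigr => b _; exact: PF.
Qed.

Theorem theorem1 (R : realType) (disp : measure_display)
    (Omega : measurableType disp) (P : probability Omega R)
    (n : nat) (hn : (1 <= n)%N)
    (T : 'I_n -> {RV P >-> bool}) (q : 'I_n -> R)
    (hq : forall i : 'I_n, 0 <= q i <= 1)
    (hT : forall i : 'I_n, P [set w : Omega | T i w = true] = (q i)%:E)
    (hind : mutually_independent T)
    (alpha : R) (halpha : 0 <= alpha <= 1) :
  (P [set w : Omega | (average q >= q_hat alpha (count_ones T w) n)%R]
     >= (1 - alpha)%:E)%E /\
  (P [set w : Omega | (average q <= 1 - q_hat alpha (n - count_ones T w)%N n)%R]
     >= (1 - alpha)%:E)%E.
Proof.
have PE := probability_count_ones _ hT hind.
split.
  rewrite (PE (fun k => q_hat alpha k n <= average q)) lee_fin.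
  exact: count_law_ge_q_hat.
rewrite (PE (fun k => average q <= 1 - q_hat alpha (n - k) n)) lee_fin.
have hq' i : 0 <= 1 - q i <= 1.
  by have /andP[? ?] := hq i; apply/andP; split; lra.
(* The first bound for the parameters [1 - q i]; the flip is carried out on [count_law] and not on
   the random variables. *)
apply: le_trans (count_law_ge_q_hat hn hq' halpha) _.
rewrite count_law_compl average_compl //; apply: count_law_le => // k _.
lra.
Qed.
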